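(* Let $n\ge 2$. For all $x,y\in\mathbb{B}^n$, $$\tanh\frac{\rho_{\mathbb{B}^n}(x,y)}{2}\le\tilde c_{\mathbb{B}^n}(x,y)\le 2\tanh\frac{\rho_{\mathbb{B}^n}(x,y)}{2},$$ and the constants are best possible: the constant $1$ in the lower bound cannot be replaced by a larger one, and the constant $2$ in the upper bound cannot be replaced by a smaller one, if the inequalities are to hold for all $x,y\in\mathbb{B}^n$.
   Context: $|\cdot|$ is the Euclidean norm and $\mathbb{B}^n=\{x\in\mathbb{R}^n:|x|<1\}$ is the unit ball. The hyperbolic metric $\rho_{\mathbb{B}^n}\ge0$ is given by $$\sinh^2\frac{\rho_{\mathbb{B}^n}(x,y)}{2}=\frac{|x-y|^2}{(1-|x|^2)(1-|y|^2)},\quad\text{equivalently}\quad \tanh\frac{\rho_{\mathbb{B}^n}(x,y)}{2}=\frac{|x-y|}{\sqrt{|x-y|^2+(1-|x|^2)(1-|y|^2)}}.$$ For a domain $G\subsetneq\mathbb{R}^n$ and $x,y\in G$, $$\tilde c_G(x,y)=\frac{|x-y|}{\inf_{z\in\partial G}\max\{|x-z|,|y-z|\}}.$$ *)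

(* Defs.v *)
From mathcomp Require Import all_boot all_order all_algebra.
From mathcomp Require Import all_classical all_reals all_analysis.
From mathcomp Require Import ring lra.

Set Implicit Arguments.
Unset Strict Implicit.
Unset Printing Implicit Defensive.

Import Order.TTheory GRing.Theory Num.Theory.
Import numFieldNormedType.Exports.

Local Open Scope classical_set_scope.
Local Open Scope ring_scope.

(* The library's norm `|u| on row vectors is the sup norm, hence this separate
   Euclidean norm; the two induce the same topology on 'rV[R]_n. *)
Definition enorm (R : realType) (n : nat) (u : 'rV[R]_n) : R :=
  Num.sqrt (\sum_(i < n) u 0 i ^+ 2).

Definition unit_ball (R : realType) (n : nat) : set 'rV[R]_n :=
  [set x | enorm x < 1].
Arguments unit_ball R n : clear implicits.

Definition boundary (T : topologicalType) (G : set T) : set T :=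
  closure G `\` interior G.

Definition sinh (R : realType) (t : R) : R := (expR t - expR (- t)) / 2.

Definition cosh (R : realType) (t : R) : R := (expR t + expR (- t)) / 2.

Definition tanh (R : realType) (t : R) : R := sinh t / cosh t.

Definition arsinh (R : realType) (t : R) : R :=
  ln (t + Num.sqrt (t ^+ 2 + 1)).

(* Meaningful for x and y in the unit ball; rho_ball_ge0, sinh_rho_ball and
   rho_ball_unique below show that there it is the only nonnegative solution
   of the defining identity for sinh^2 (rho / 2). *)
Definition rho_ball (R : realType) (n : nat) (x y : 'rV[R]_n) : R :=
  2 * arsinh (enorm (x - y)
              / Num.sqrt ((1 - enorm x ^+ 2) * (1 - enorm y ^+ 2))).

(* Meaningful for x and y in a proper subdomain G of R^n. *)
Definition c_tilde (R : realType) (n : nat) (G : set 'rV[R]_n)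
    (x y : 'rV[R]_n) : R :=
  enorm (x - y)
  / inf [set Num.max (enorm (x - z)) (enorm (y - z)) | z in boundary G].

Lemma arsinh_arg_gt0 (R : realType) (t : R) : 0 < t + Num.sqrt (t ^+ 2 + 1).
Proof.
have h : `|t| < Num.sqrt (t ^+ 2 + 1).
  by rewrite -sqrtr_sqr ltr_sqrt; have := sqr_ge0 t; lra.
by have := ler_norm (- t); rewrite normrN; lra.
Qed.

Lemma arsinhK (R : realType) (t : R) : sinh (arsinh t) = t.
Proof.
rewrite /sinh /arsinh expRN lnK ?posrE ?arsinh_arg_gt0//.
have p := arsinh_arg_gt0 t.
have q : Num.sqrt (t ^+ 2 + 1) ^+ 2 = t ^+ 2 + 1.
  by rewrite sqr_sqrtr//; have := sqr_ge0 t; lra.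
have -> : (t + Num.sqrt (t ^+ 2 + 1))^-1 = Num.sqrt (t ^+ 2 + 1) - t.
  apply: (mulfI (lt0r_neq0 p)); rewrite divff ?lt0r_neq0//.
  by transitivity (Num.sqrt (t ^+ 2 + 1) ^+ 2 - t ^+ 2); [rewrite q|]; ring.
by field.
Qed.

Lemma sinhK (R : realType) (t : R) : arsinh (sinh t) = t.
Proof.
have h : sinh t ^+ 2 + 1 = cosh t ^+ 2.
  by rewrite /sinh /cosh expRN; have := expR_gt0 t; move=> /lt0r_neq0 ?; field.
rewrite /arsinh h sqrtr_sqr ger0_norm; last first.
  by rewrite /cosh; have := expR_gt0 t; have := expR_gt0 (- t); lra.
have -> : sinh t + cosh t = expR t by rewrite /sinh /cosh; field.
by rewrite expRK.
Qed.

Lemma arsinh_ge0 (R : realType) (t : R) : 0 <= t -> 0 <= arsinh t.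
Proof.
move=> t0; apply: ln_ge0.
have : Num.sqrt 1 <= Num.sqrt (t ^+ 2 + 1).
  by apply: ler_wsqrtr; have := sqr_ge0 t; lra.
by rewrite sqrtr1; lra.
Qed.

Lemma sinh_ge0 (R : realType) (t : R) : 0 <= t -> 0 <= sinh t.
Proof.
move=> t0; have : expR (- t) <= expR t by rewrite ler_expR; lra.
by rewrite /sinh; lra.
Qed.

Lemma enorm_ge0 (R : realType) (n : nat) (u : 'rV[R]_n) : 0 <= enorm u.
Proof. exact: sqrtr_ge0. Qed.

Lemma rho_ball_ge0 (R : realType) (n : nat) (x y : 'rV[R]_n) :
  0 <= rho_ball x y.
Proof.
by rewrite /rho_ball mulr_ge0// arsinh_ge0// divr_ge0 ?enorm_ge0 ?sqrtr_ge0.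
Qed.

Lemma sinh_rho_ball (R : realType) (n : nat) (x y : 'rV[R]_n) :
  unit_ball R n x -> unit_ball R n y ->
  sinh (rho_ball x y / 2) ^+ 2 =
  enorm (x - y) ^+ 2 / ((1 - enorm x ^+ 2) * (1 - enorm y ^+ 2)).
Proof.
rewrite /unit_ball /= => x1 y1.
rewrite /rho_ball [2 * _]mulrC mulfK// arsinhK expr_div_n.
by rewrite (sqr_sqrtr (a := (1 - _) * _)) // mulr_ge0// subr_ge0 exprn_ile1 ?enorm_ge0 ?(ltW x1) ?(ltW y1).
Qed.

Lemma rho_ball_unique (R : realType) (n : nat) (x y : 'rV[R]_n) (r : R) :
  unit_ball R n x -> unit_ball R n y -> 0 <= r ->
  sinh (r / 2) ^+ 2 =
  enorm (x - y) ^+ 2 / ((1 - enorm x ^+ 2) * (1 - enorm y ^+ 2)) ->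
  r = rho_ball x y.
Proof.
move=> x1 y1 r0; rewrite -sinh_rho_ball// => /eqP.
have s0 := rho_ball_ge0 x y.
rewrite eqrXn2 ?sinh_ge0 ?divr_ge0// => /eqP /(congr1 (@arsinh R)).
by rewrite !sinhK; lra.
Qed.

(* Main.v *)
Require Import Defs.
From mathcomp Require Import all_boot all_order all_algebra.
From mathcomp Require Import all_classical all_reals all_analysis.
From mathcomp Require Import ring lra.
Import Order.TTheory GRing.Theory Num.Theory.
Import numFieldNormedType.Exports.
Local Open Scope classical_set_scope.
Local Open Scope ring_scope.

(* Let A = sqrt (|x - y|^2 + (1 - |x|^2) (1 - |y|^2)) be the Ahlfors bracket
   (A = |1 - conj(x) y| in the plane), so that tanh (rho / 2) = |x - y| / A.
   The two inequalities say that the infimum m of max (|x - z|, |y - z|) over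
   the unit sphere satisfies A / 2 <= m <= A.  The first holds for every z, by
   A <= |x - z| + |x| |y - z|.  For the second one exhibits a suitable z: when
   x . y > 0, the bisector of the angle between x and y; otherwise a point
   equidistant from x and y.  The lower bound is an equality at x = 0, and the
   ratio A / m tends to 2 for x = r e and y = (r + (1 - r)^2) e with r -> 1. *)

(** * The Euclidean inner product and the continuity of the norm *)

Definition dot {R : realType} {n : nat} (u v : 'rV[R]_n) : R :=
  \sum_(i < n) u 0 i * v 0 i.

Section InnerProduct.
Context {R : realType} {n : nat}.
Implicit Types (u v w x y z : 'rV[R]_n) (a : R).

Lemma dotC u v : dot u v = dot v u.
Proof. by apply: eq_bigr => i _; rewrite mulrC. Qed.

Lemma dotDl u v w : dot (u + v) w = dot u w + dot v w.
Proof. by rewrite -big_split; apply: eq_bigr => i _; rewrite mxE mulrDl. Qed.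

Lemma dotZl a u v : dot (a *: u) v = a * dot u v.
Proof. by rewrite mulr_sumr; apply: eq_bigr => i _; rewrite mxE mulrA. Qed.

Lemma dotDr u v w : dot w (u + v) = dot w u + dot w v.
Proof. by rewrite dotC dotDl !(dotC w). Qed.

Lemma dotZr a u v : dot u (a *: v) = a * dot u v.
Proof. by rewrite dotC dotZl dotC. Qed.

Lemma dot0l u : dot 0 u = 0.
Proof. by rewrite -(scale0r 0) dotZl mul0r. Qed.

Lemma dot0r u : dot u 0 = 0.
Proof. by rewrite dotC dot0l. Qed.

Lemma dotNl u v : dot (- u) v = - dot u v.
Proof. by rewrite -scaleN1r dotZl mulN1r. Qed.

Lemma dotNr u v : dot u (- v) = - dot u v.
Proof. by rewrite dotC dotNl dotC. Qed.

Definition dotE := (dotDl, dotDr, dotNl, dotNr, dotZl, dotZr).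

Lemma dot_delta u i : dot u (delta_mx 0 i) = u 0 i.
Proof.
rewrite /dot (bigD1 i)//= mxE !eqxx mulr1 big1 ?addr0// => j ji.
by rewrite mxE (negbTE ji) andbF mulr0.
Qed.

Lemma dot_ge0 u : 0 <= dot u u.
Proof. by apply: sumr_ge0 => i _; rewrite -expr2 sqr_ge0. Qed.

Lemma dot_eq0 u : dot u u = 0 -> u = 0.
Proof.
move=> /eqP; rewrite psumr_eq0; last by move=> i _; rewrite -expr2 sqr_ge0.
move=> /allP u0; apply/rowP => i; rewrite mxE; apply/eqP.
by have /= := u0 i (mem_index_enum _); rewrite mulf_eq0 orbb.
Qed.

Lemma enormE u : enorm u = Num.sqrt (dot u u).
Proof. by congr Num.sqrt; apply: eq_bigr => i _; rewrite expr2. Qed.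

Lemma sqr_enorm u : enorm u ^+ 2 = dot u u.
Proof. by rewrite enormE sqr_sqrtr// dot_ge0. Qed.

Lemma enorm_lt1 u : (enorm u < 1) = (dot u u < 1).
Proof. by rewrite -sqr_enorm expr_lt1// enorm_ge0. Qed.

Lemma enorm_eq1 u : enorm u = 1 <-> dot u u = 1.
Proof.
rewrite -sqr_enorm; split=> [->|/eqP]; first by rewrite expr1n.
by rewrite pexpr_eq1 ?enorm_ge0// => /eqP.
Qed.

Lemma enormZ a u : 0 <= a -> enorm (a *: u) = a * enorm u.
Proof.
move=> a0; rewrite !enormE !dotE mulrA -expr2 sqrtrM ?sqr_ge0//.
by rewrite sqrtr_sqr ger0_norm.
Qed.

Lemma enorm_le (b : R) u : 0 <= b -> (enorm u <= b) = (dot u u <= b ^+ 2).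
Proof. by move=> b0; rewrite -sqr_enorm ler_sqr// nnegrE enorm_ge0. Qed.

Lemma enorm_continuous : continuous (@enorm R n).
Proof.
move=> u; apply: (@continuous_comp _ _ _ _ Num.sqrt); last exact: sqrt_continuous.
apply: cvg_big; [exact: add_continuous | exact: (nbhs_filter u) | move=> i _].
apply: (@continuous_comp _ _ _ (fun v : 'rV[R]_n => v 0 i) (fun t => t ^+ 2)).
  exact: coord_continuous.
exact: exprn_continuous.
Qed.

End InnerProduct.

(** * The unit sphere as boundary, bounds on [c_tilde], and the Ahlfors bracket *)

Section UnitBall.
Context {R : realType} {n : nat}.
Implicit Types x y z : 'rV[R]_n.

(** By continuity of [enorm] the ball is open and its closure stays in the closed ball; conversely a
    unit vector z is the limit of t z as t < 1 tends to 1. *)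
Lemma boundary_unit_ball :
  boundary (unit_ball R n) = [set z : 'rV[R]_n | enorm z = 1].
Proof.
have oB : open (unit_ball R n).
  apply: (@open_comp _ _ (@enorm R n) [set t | t < 1]); last exact: open_lt.
  by move=> z _; exact: enorm_continuous.
rewrite /boundary (interior_id _).1//; apply/seteqP; split=> z /=.
  move=> [cz /negP]; rewrite -leNgt => z1; apply/eqP; rewrite eq_le z1 andbT.
  have cC : closed [set z : 'rV[R]_n | enorm z <= 1].
    apply: (@preimage_closed _ _ (@enorm R n) [set t | t <= 1]); last exact: closed_le.
    by move=> w _; exact: enorm_continuous.
  move/closure_id: cC => /seteqP[_]; apply.
  by apply: closureS cz => w /=; exact: ltW.
move=> z1; split; last by rewrite /unit_ball/= z1 ltxx.
move=> B nB.
have c1 : (fun t : R => t *: z) @ (1 : R) --> z.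
  by rewrite -[X in _ --> X]scale1r; apply: scalel_continuous.
have /nbhs_ballP[e /= e0 eB] := c1 _ nB.
(* The cap 1 / 2 keeps t nonnegative, as [enormZ] requires; e / 2 keeps t within e of 1. *)
pose t := 1 - Num.min (e / 2) (1 / 2).
have m0 : 0 < Num.min (e / 2) (1 / 2) by rewrite lt_min; apply/andP; split; lra.
have m1 : Num.min (e / 2) (1 / 2) <= 1 / 2 by rewrite ge_min lexx orbT.
have m2 : Num.min (e / 2) (1 / 2) <= e / 2 by rewrite ge_min lexx.
exists (t *: z); split.
  by rewrite /unit_ball/= enormZ ?z1 /t; lra.
by apply: eB; rewrite /ball/= /t opprB addrC subrK ger0_norm; lra.
Qed.

(** The point of the sphere ensures that the infimum is not taken over the empty set, where it would
    have the default value 0. *)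
Lemma c_tilde_le x y (b : R) : 0 < b ->
  (exists z, enorm z = 1) ->
  (forall z, enorm z = 1 -> b <= Num.max (enorm (x - z)) (enorm (y - z))) ->
  c_tilde (unit_ball R n) x y <= enorm (x - y) / b.
Proof.
move=> b0 [z z1] hb; rewrite /c_tilde boundary_unit_ball.
set S := image _ _; have bS : b <= inf S.
  apply: lb_le_inf; first by exists (Num.max (enorm (x - z)) (enorm (y - z))), z.
  by move=> _ [w w1 <-]; exact: hb.
by rewrite ler_wpM2l ?enorm_ge0// lef_pV2// posrE (lt_le_trans b0).
Qed.

(* The positive lower bound [m] keeps the infimum away from the junk value of
   division by zero. *)
Lemma c_tilde_ge x y z (m b : R) : 0 < m ->
  (forall z, enorm z = 1 -> m <= Num.max (enorm (x - z)) (enorm (y - z))) ->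
  enorm z = 1 -> enorm (x - z) <= b -> enorm (y - z) <= b ->
  enorm (x - y) / b <= c_tilde (unit_ball R n) x y.
Proof.
move=> m0 hm z1 xb yb; rewrite /c_tilde boundary_unit_ball.
set S := image _ _.
have mS : lbound S m by move=> _ [w w1 <-]; exact: hm.
have Sz : S (Num.max (enorm (x - z)) (enorm (y - z))) by exists z.
have iS : m <= inf S by apply: lb_le_inf mS; eexists; exact: Sz.
have Sb : inf S <= b.
  by apply: le_trans (ge_inf _ Sz) _; [exists m | rewrite ge_max xb yb].
have i0 := lt_le_trans m0 iS.
by rewrite ler_wpM2l ?enorm_ge0// lef_pV2// posrE// (lt_le_trans i0).
Qed.

(** For nonzero x this is |x| |y - x / |x|^2|, with the inverse point of x; the expanded form also
    covers x = 0. *)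
Definition ahlfors_bracket x y : R :=
  Num.sqrt (1 - 2 * dot x y + dot x x * dot y y).

Lemma ahlfors_radicand x y : 1 - 2 * dot x y + dot x x * dot y y =
  dot (x - y) (x - y) + (1 - dot x x) * (1 - dot y y).
Proof. by rewrite !dotE (dotC y x); ring. Qed.

Lemma ahlfors_radicand_gt0 {x y} : dot x x < 1 -> dot y y < 1 ->
  0 < 1 - 2 * dot x y + dot x x * dot y y.
Proof.
move=> x1 y1; rewrite ahlfors_radicand ltr_wpDl ?dot_ge0//.
by rewrite mulr_gt0// subr_gt0.
Qed.

Lemma ahlfors_gt0 x y : dot x x < 1 -> dot y y < 1 -> 0 < ahlfors_bracket x y.
Proof. by move=> x1 y1; rewrite sqrtr_gt0 ahlfors_radicand_gt0. Qed.

Lemma sqr_ahlfors x y : dot x x < 1 -> dot y y < 1 ->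
  ahlfors_bracket x y ^+ 2 = 1 - 2 * dot x y + dot x x * dot y y.
Proof. by move=> x1 y1; rewrite sqr_sqrtr// ltW// ahlfors_radicand_gt0. Qed.

Lemma tanh_arsinh (t : R) : tanh (arsinh t) = t / Num.sqrt (t ^+ 2 + 1).
Proof.
rewrite /tanh arsinhK; congr (_ / _).
have h : cosh (arsinh t) ^+ 2 = t ^+ 2 + 1.
  rewrite -{2}(arsinhK t) /cosh /sinh expRN.
  by have := expR_gt0 (arsinh t) => /lt0r_neq0 ?; field.
rewrite -h sqrtr_sqr ger0_norm// /cosh.
by rewrite divr_ge0// addr_ge0// expR_ge0.
Qed.

Lemma tanh_rho_ball x y : dot x x < 1 -> dot y y < 1 ->
  tanh (rho_ball x y / 2) = enorm (x - y) / ahlfors_bracket x y.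
Proof.
move=> x1 y1; rewrite /rho_ball [2 * _]mulrC mulfK// tanh_arsinh !sqr_enorm.
have P0 : 0 < (1 - dot x x) * (1 - dot y y) by rewrite mulr_gt0// subr_gt0.
rewrite /ahlfors_bracket ahlfors_radicand; move: (_ * _) P0 => P P0.
have s0 : 0 < Num.sqrt P by rewrite sqrtr_gt0.
rewrite expr_div_n sqr_enorm sqr_sqrtr ?ltW//.
have -> : dot (x - y) (x - y) + P = (dot (x - y) (x - y) / P + 1) * P.
  by field; exact: lt0r_neq0.
rewrite sqrtrM; last by rewrite addr_ge0 ?divr_ge0 ?dot_ge0// ltW.
by rewrite invfM mulrA mulrAC.
Qed.

(* With r = |x|, the vectors r (y - z) and r z - x / r add up to r y - x / r,
   of norm [ahlfors_bracket x y], while the second one has norm |x - z| because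
   |z| = 1; the proof clears the denominators r. *)
Lemma ahlfors_le_max x y z : dot x x < 1 -> dot y y < 1 -> enorm z = 1 ->
  ahlfors_bracket x y / 2 <= Num.max (enorm (x - z)) (enorm (y - z)).
Proof.
move=> x1 y1 /enorm_eq1 z1; set M := Num.max _ _.
have xM : enorm (x - z) <= M by rewrite le_max lexx.
have yM : enorm (y - z) <= M by rewrite le_max lexx orbT.
have M0 : 0 <= M := le_trans (enorm_ge0 _) xM.
rewrite ler_pdivrMr// -ler_sqr ?nnegrE ?sqrtr_ge0 ?mulr_ge0// sqr_ahlfors//.
move: xM yM; rewrite !enorm_le// !dotE !(dotC z) z1 => xM yM.
have [r0|r0] := eqVneq (dot x x) 0.
  move/dot_eq0: r0 => r0; move: xM; rewrite r0 !(dot0l, dot0r); nra.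
have rp : 0 < dot x x by rewrite lt_neqAle eq_sym r0 dot_ge0.
(* This is |u + v|^2 <= 2 |u|^2 + 2 |v|^2; divided by |x|^2 it gives A^2 <= 2 |x|^2 |y - z|^2 + 2 |x
   - z|^2 <= 4 M^2. *)
have h := dot_ge0 (dot x x *: (y - z) - (dot x x *: z - x)).
have Y0 := dot_ge0 (y - z).
move: h Y0; rewrite !dotE !(dotC z) (dotC y x) z1.
set r := dot x x in rp x1 xM *; set s := dot y y in yM y1 *; set p := dot x y.
set a := dot x z in xM *; set b := dot y z in yM *.
move=> h Y0; rewrite -(ler_pM2l rp).
have hX : 0 <= r * (M ^+ 2 - (r - a - (a - 1))) by apply: mulr_ge0 (ltW rp) _; lra.
have hY : 0 <= r * (M ^+ 2 - r * (s - b - (b - 1))).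
  apply: mulr_ge0 (ltW rp) _.
  by have : 0 <= (1 - r) * (s - b - (b - 1)); [rewrite mulr_ge0//; lra | lra].
lra.
Qed.

End UnitBall.

(** * A point of the sphere within the Ahlfors bracket of both x and y *)

Section Equidistant.
Context {R : realType} {n : nat}.
Implicit Types x y z : 'rV[R]_n.

Lemma enorm_delta (i : 'I_n) : enorm (delta_mx 0 i : 'rV[R]_n) = 1.
Proof. by apply/enorm_eq1; rewrite dot_delta mxE !eqxx. Qed.

(** A quarter turn of the first two coordinates gives e, unless the first one vanishes; then the
    first basis vector serves. *)
Lemma exists_orthogonal u : (2 <= n)%N ->
  exists2 e : 'rV[R]_n, dot u e = 0 & 0 < dot e e.
Proof.
move=> n2; pose i := Ordinal (ltnW n2); pose j := Ordinal n2.
have [ui|ui] := eqVneq (u 0 i) 0.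
  by exists (delta_mx 0 i); rewrite dot_delta// mxE !eqxx ltr01.
exists (u 0 i *: delta_mx 0 j - u 0 j *: delta_mx 0 i).
  by rewrite !dotE !dot_delta; ring.
rewrite !dotE !dot_delta !mxE !eqxx/= !(mulr0, mulr1, subr0, sub0r, oppr0).
by rewrite ltr_pwDl// ?exprn_even_gt0//; nra.
Qed.

(** The equation is quadratic in k with constant term |m|^2 - 1 < 0, so its larger root is
    nonnegative. *)
Lemma exists_sphere_ray (m e : 'rV[R]_n) : dot m m < 1 -> 0 < dot e e ->
  exists2 k : R, 0 <= k & dot (m + k *: e) (m + k *: e) = 1.
Proof.
move=> m1 e0; set a := dot e e in e0; set b := dot m e.
pose D := b ^+ 2 + a * (1 - dot m m).
have D0 : b ^+ 2 <= D by rewrite lerDl mulr_ge0// ?ltW// subr_gt0.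
have sD : Num.sqrt D ^+ 2 = D by rewrite sqr_sqrtr// (le_trans (sqr_ge0 b)).
exists ((Num.sqrt D - b) / a).
  apply: divr_ge0 (ltW e0); rewrite subr_ge0 (le_trans (ler_norm b))//.
  by rewrite -sqrtr_sqr ler_wsqrtr.
rewrite !dotE (dotC e m) -/a -/b.
transitivity (dot m m + (Num.sqrt D ^+ 2 - b ^+ 2) / a).
  by field; exact: lt0r_neq0.
by rewrite sD /D; field; exact: lt0r_neq0.
Qed.

Lemma exists_sphere_le_ahlfors x y : (2 <= n)%N -> dot x x < 1 -> dot y y < 1 ->
  exists z, [/\ enorm z = 1, enorm (x - z) <= ahlfors_bracket x y
    & enorm (y - z) <= ahlfors_bracket x y].
Proof.
move=> n2 x1 y1.
(* Squaring and using |z| = 1 turns both distance bounds into conditions linear in z. *)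
suff [z [z1 hx hy]] : exists z, [/\ dot z z = 1,
    2 * dot x y + dot x x * (1 - dot y y) <= 2 * dot x z
  & 2 * dot x y + dot y y * (1 - dot x x) <= 2 * dot y z].
  have A0 := ltW (ahlfors_gt0 _ _ x1 y1).
  exists z; rewrite !enorm_le// !sqr_ahlfors// !dotE !(dotC z) z1.
  by split; [exact/enorm_eq1 | lra | lra].
have [p0|p0] := leP (dot x y) 0.
  (* z is equidistant from x and y, obtained by moving from their midpoint
     orthogonally to x - y and away from the origin. *)
  have [e ue e0] := exists_orthogonal (x - y) n2.
  wlog xe : e ue e0 / 0 <= dot x e.
    move=> H; have [|/ltW xe] := leP 0 (dot x e); first exact: H.
    by apply: (H (- e)); move: ue; rewrite !dotE ?opprK; lra.
  have m1 : dot (2^-1 *: (x + y)) (2^-1 *: (x + y)) < 1.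
    by have := dot_ge0 (x - y); rewrite !dotE (dotC y x); lra.
  have [k k0 hk] := exists_sphere_ray _ _ m1 e0.
  have kxe := mulr_ge0 k0 xe.
  have ye : dot y e = dot x e by move: ue; rewrite !dotE; lra.
  have rs := mulr_ge0 (dot_ge0 x) (dot_ge0 y).
  exists (2^-1 *: (x + y) + k *: e).
  (* Since 2 x.z = |x|^2 + x.y + 2 k x.e, the sign x.y <= 0 yields 2 x.z >= |x|^2 + 2 x.y; likewise
     for y. *)
  by split=> //; rewrite !dotE ?ye ?(dotC y x); lra.
(* z is the direction bisecting the angle, of cosine c, between x and y. *)
have gt0 (u : 'rV[R]_n) : 0 < dot u u \/ u = 0.
  have := dot_ge0 u; rewrite le_eqVlt => /orP[/eqP/esym/dot_eq0|]; by [right|left].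
have [r0|x0] := gt0 x; last by move: p0; rewrite x0 dot0l ltxx.
have [s0|y0] := gt0 y; last by move: p0; rewrite y0 dot0r ltxx.
have r0' : 0 < enorm x by rewrite enormE sqrtr_gt0.
have s0' : 0 < enorm y by rewrite enormE sqrtr_gt0.
move: x1 y1 r0 s0; rewrite -!sqr_enorm.
set r := enorm x in r0' *; set s := enorm y in s0' * => x1 y1 _ _.
pose c := dot x y / (r * s).
have pE : dot x y = r * s * c.
  by rewrite /c; field; rewrite !lt0r_neq0.
have c0 : 0 < c by rewrite divr_gt0// mulr_gt0.
have c1 : c <= 1.
  have := dot_ge0 (r^-1 *: x - s^-1 *: y).
  rewrite !dotE (dotC y x) pE -!sqr_enorm -/r -/s.
  rewrite (_ : _ + _ = 2 - 2 * c); first by lra.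
  by field; rewrite !lt0r_neq0.
(* N is the norm of x / r + y / s. As N <= 2, replacing 1 / N by 1 / 2 below leaves inequalities
   polynomial in r, s and c. *)
pose N := Num.sqrt (2 + 2 * c).
have N0 : 0 < N by rewrite sqrtr_gt0; lra.
have N2 : N ^+ 2 = 2 + 2 * c by rewrite sqr_sqrtr//; lra.
have NV : 2^-1 <= N^-1 by rewrite lef_pV2// ?posrE// -ler_sqr ?nnegrE; nra.
have r1 : r <= 1 by nra.
have s1 : s <= 1 by nra.
exists (N^-1 *: (r^-1 *: x + s^-1 *: y)); split.
- rewrite !dotE (dotC y x) pE -!sqr_enorm -/r -/s.
  rewrite (_ : _ * _ = (2 + 2 * c) / N ^+ 2); last by field; rewrite !lt0r_neq0.
  by rewrite N2 divff// lt0r_neq0; lra.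
- rewrite !dotE pE -!sqr_enorm -/r -/s.
  rewrite (_ : N^-1 * _ = r * (1 + c) * N^-1); last by field; rewrite !lt0r_neq0.
  have : r * (1 + c) * 2^-1 <= r * (1 + c) * N^-1 by rewrite ler_wpM2l//; nra.
  (* As r <= 1, the second factor is at least c - 2 s c + s^2 = (c - s)^2 + c (1 - c). *)
  suff : 0 <= r * (1 + c - 2 * s * c - r * (1 - s ^+ 2)) by lra.
  apply: (mulr_ge0 (ltW r0')); have : 0 <= (1 - r) * (1 - s ^+ 2) by nra.
  by have := sqr_ge0 (c - s); nra.
- rewrite !dotE (dotC y x) pE -!sqr_enorm -/r -/s.
  rewrite (_ : N^-1 * _ = s * (1 + c) * N^-1); last by field; rewrite !lt0r_neq0.
  have : s * (1 + c) * 2^-1 <= s * (1 + c) * N^-1 by rewrite ler_wpM2l//; nra.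
  suff : 0 <= s * (1 + c - 2 * r * c - s * (1 - r ^+ 2)) by lra.
  apply: (mulr_ge0 (ltW s0')); have : 0 <= (1 - s) * (1 - r ^+ 2) by nra.
  by have := sqr_ge0 (c - r); nra.
Qed.

End Equidistant.

(** * The two inequalities and their sharpness *)

Theorem theorem3p13 (R : realType) (n : nat) (hn : (2 <= n)%N) :
  (forall x y : 'rV[R]_n, unit_ball R n x -> unit_ball R n y ->
     tanh (rho_ball x y / 2) <= c_tilde (unit_ball R n) x y /\
     c_tilde (unit_ball R n) x y <= 2 * tanh (rho_ball x y / 2)) /\
  (forall c : R,
     (forall x y : 'rV[R]_n, unit_ball R n x -> unit_ball R n y ->
        c * tanh (rho_ball x y / 2) <= c_tilde (unit_ball R n) x y) ->
     c <= 1) /\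
  (forall c : R,
     (forall x y : 'rV[R]_n, unit_ball R n x -> unit_ball R n y ->
        c_tilde (unit_ball R n) x y <= c * tanh (rho_ball x y / 2)) ->
     2 <= c).
Proof.
have unitB x : unit_ball R n x = (dot x x < 1) :> Prop by rewrite /unit_ball/= enorm_lt1.
pose e : 'rV[R]_n := delta_mx 0 (Ordinal (ltnW hn)).
have e1 : enorm e = 1 by exact: enorm_delta.
have ee : dot e e = 1 by exact/enorm_eq1.
have A0 (x y : 'rV[R]_n) : dot x x < 1 -> dot y y < 1 -> 0 < ahlfors_bracket x y / 2.
  by move=> x1 y1; rewrite divr_gt0// ahlfors_gt0.
split; [|split].
- move=> x y; rewrite !unitB => x1 y1; rewrite tanh_rho_ball//; split.
    have [z [z1 xz yz]] := exists_sphere_le_ahlfors x y hn x1 y1.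
    apply: (c_tilde_ge _ _ z _ _ (A0 _ _ x1 y1)) => // w w1.
    exact: ahlfors_le_max.
  rewrite (_ : 2 * _ = enorm (x - y) / (ahlfors_bracket x y / 2)); last first.
    by field; rewrite lt0r_neq0// ahlfors_gt0.
  apply: c_tilde_le; [exact: A0 | by exists e | move=> z z1].
  exact: ahlfors_le_max.
- move=> c /(_ 0 (2^-1 *: e)); rewrite !unitB.
  have z1 : dot (0 : 'rV[R]_n) 0 < 1 by rewrite dot0l.
  have h1 : dot (2^-1 *: e) (2^-1 *: e) < 1 by rewrite !dotE ee; lra.
  move=> /(_ z1 h1); rewrite tanh_rho_ball// /ahlfors_bracket.
  (* Writing the origin as [0 *: e] reduces every product to [dot e e]. *)
  rewrite -(scale0r e) !dotE !mul0r mulr0 subr0 addr0 sqrtr1 divr1.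
  have d : enorm (0 *: e - 2^-1 *: e) = 2^-1.
    rewrite -scalerBl sub0r enormE !dotE ee mulr1 mulrNN -expr2 sqrtr_sqr.
    by rewrite ger0_norm// invr_ge0.
  have := @c_tilde_le R n (0 *: e) (2^-1 *: e) 1 ltr01 (ex_intro _ e e1).
  rewrite d divr1 => H; have : c_tilde (unit_ball R n) (0 *: e) (2^-1 *: e) <= 2^-1.
    apply: H => z hz; rewrite le_max scale0r sub0r.
    by rewrite enormE dotNl dotNr opprK -enormE hz lexx.
  lra.
- move=> c hc.
  have key (r : R) : 0 < r -> r < 1 -> 2 * r <= c.
    (* The gap (1 - r)^2 is of smaller order than the distance 1 - r to the sphere: A = 1 - r s = (1
       + r^2) (1 - r), while the maximum at z = e is 1 - r. This gives 1 + r^2 <= c, weakened to 2 r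
       <= c. *)
    move=> r0 r1; pose s := r + (1 - r) ^+ 2.
    have sr : r < s by rewrite /s; nra.
    have s1 : s < 1 by rewrite /s; nra.
    have rx : dot (r *: e) (r *: e) < 1 by rewrite !dotE ee; nra.
    have sx : dot (s *: e) (s *: e) < 1 by rewrite !dotE ee; nra.
    have := hc (r *: e) (s *: e); rewrite !unitB => /(_ rx sx).
    have AE : ahlfors_bracket (r *: e) (s *: e) = 1 - r * s.
      rewrite /ahlfors_bracket !dotE ee (_ : 1 - _ + _ = (1 - r * s) ^+ 2); last by ring.
      by rewrite sqrtr_sqr ger0_norm//; nra.
    rewrite tanh_rho_ball// AE => h.
    have dist (t : R) : t <= 1 -> enorm (t *: e - e) = 1 - t.
      move=> t1; rewrite -[X in _ - X]scale1r -scalerBl enormE !dotE ee mulr1 -expr2.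
      by rewrite sqrtr_sqr ler0_norm; lra.
    have : enorm (r *: e - s *: e) / (1 - r) <= c_tilde (unit_ball R n) (r *: e) (s *: e).
      apply: (c_tilde_ge _ _ e _ _ (A0 _ _ rx sx)) => //.
      + by move=> w w1; exact: ahlfors_le_max.
      + by rewrite dist// ltW.
      + by rewrite dist ?ltW//; lra.
    have dE : enorm (r *: e - s *: e) = s - r.
      rewrite -scalerBl enormE !dotE ee mulr1 -expr2.
      by rewrite sqrtr_sqr ler0_norm; lra.
    move=> /le_trans /(_ h); rewrite dE.
    rewrite mulrCA ler_pM2l ?subr_gt0// ler_pdivlMr; last by nra.
    rewrite mulrC ler_pdivrMr ?subr_gt0//.
    have -> : 1 - r * s = (1 + r ^+ 2) * (1 - r) by rewrite /s; ring.
    rewrite ler_pM2r ?subr_gt0// => hr; apply: le_trans hr.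
    by have := sqr_ge0 (1 - r); lra.
  have c1 : 1 <= c by have := key 2^-1; lra.
  rewrite leNgt; apply/negP => c2.
  (* For 1 <= c < 2 this r lies in (0, 1), and 2 r is the midpoint of c and 2, hence exceeds c. *)
  have := key ((c + 2) / 4); lra.
Qed.
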